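(* Consider the PEPS associated to a classical spin model with $d\ge 2$ configurations per site and nearest-neighbour interactions on a finite simple graph $(V,\mathcal{E})$ (so that the bond dimension is $D=d$), and assume that all the $d\times d$ matrices $\phi^{(e,i)}$ are invertible. Let $R\subseteq V$ be a nonempty set of sites, and let $\bar R\subseteq R$ be the set of sites of $R$ having at least one outgoing edge (edge to a site outside $R$). Assume that for every configuration $\bar x$ on $\bar R$ there is at least one configuration $x$ on $R$ restricting to $\bar x$ with $C(x)\neq 0$. Then the region $R$ is injective if and only if every site of $R$ has at most one outgoing edge. In particular, the injectivity of $R$ depends only on the geometry of the graph and not on the interaction.
   Context: Classical model: real functions $h_e:\{1,\dots,d\}^2\to\mathbb{R}$ for each edge $e=(i,j)$ (with a chosen ordering of its endpoints), energy $H(x)=\sum_{e=(i,j)\in\mathcal{E}}h_e(x_i,x_j)$ for $x\in\{1,\dots,d\}^V$, and inverse temperature $\beta$. The associated PEPS is the state $\frac{1}{\sqrt Z}\sum_x e^{-\frac{\beta}{2}H(x)}|x\rangle$, with the following tensors. For each edge $e=(i,j)$ choose $d\times d$ matrices $\phi^{(e,i)},\phi^{(e,j)}$ with $\sum_{\alpha=1}^d \phi^{(e,i)}_{x,\alpha}\,\phi^{(e,j)}_{y,\alpha}=\exp[-\frac{\beta}{2}h_e(x,y)]$ for all $x,y$; the tensor at site $i$ for physical index $x_i$ is $A^{(i)}_{x_i;(\alpha_e)_{e\ni i}}=\prod_{e\ni i}\phi^{(e,i)}_{x_i,\alpha_e}$, with one $d$-dimensional index $\alpha_e$ for each edge $e$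 at $i$. For a nonempty set of sites $R$, let $E$ be the set of edges with exactly one endpoint in $R$ (outgoing edges). For $x=(x_i)_{i\in R}$ let $A_x$ be the tensor with indices $\bar\alpha=(\alpha_e)_{e\in E}$ obtained from $(A^{(i)}_{x_i})_{i\in R}$ by identifying and summing over $\alpha_e$ for all edges $e$ with both endpoints in $R$. Define $\Gamma_R:(\mathbb{C}^d)^{\otimes|E|}\to(\mathbb{C}^d)^{\otimes|R|}$ by $\langle x|\Gamma_R|\bar\alpha\rangle=(A_x)_{\bar\alpha}$. The region $R$ is injective if $\Gamma_R$ is injective. $C(x)$ denotes the factor resulting from the contractions along all edges with both endpoints in $R$, i.e. $C(x)=\prod_{e=(i,j):\,i,j\in R}\ \sum_{\alpha}\phi^{(e,i)}_{x_i,\alpha}\phi^{(e,j)}_{x_j,\alpha}$. *)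

(* Defs.v *)
From HB Require Import structures.
From mathcomp Require Import all_boot all_order all_algebra.
From mathcomp Require Import complex.
From mathcomp Require Import reals sequences exp.

Set Implicit Arguments.
Unset Strict Implicit.
Unset Printing Implicit Defensive.

Import Order.TTheory GRing.Theory Num.Theory.
Local Open Scope ring_scope.
Local Open Scope complex_scope.

(* A family of values in ['I_d] indexed by the members of a finite set [A]:
   a spin configuration if [A] is a set of sites, an assignment of bond indices
   if [A] is a set of edges.  The space [(C^d)^{(x)|A|}] is identified, through
   its computational basis, with [{ffun conf A d -> C}]. *)
Notation conf A d := {ffun {x | x \in A} -> 'I_d}.

Definition incl (T : finType) (A B : {set T}) (sAB : A \subset B)
    (x : {x | x \in A}) : {x | x \in B} :=
  exist _ (val x) (subsetP sAB (val x) (valP x)).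

Definition restr (T : finType) (d : nat) (A B : {set T}) (sAB : A \subset B)
    (f : conf B d) : conf A d :=
  [ffun x => f (incl sAB x)].

Definition edge_set (V : finType) (adj : rel V) : {set {set V}} :=
  [set e : {set V} | [exists i, exists j, adj i j && (e == [set i; j])]].

Definition edge (V : finType) (adj : rel V) : finType :=
  {e : {set V} | e \in edge_set adj}.

Section Regions.
Variables (V : finType) (adj : rel V).
Implicit Types (i : V) (R : {set V}) (e : edge adj).

Definition incident i : {set edge adj} := [set e : edge adj | i \in val e].

Definition touching R : {set edge adj} :=
  [set e : edge adj | [exists i in R, i \in val e]].

Definition inner R : {set edge adj} := [set e : edge adj | val e \subset R].

(* Edges with exactly one endpoint in [R]. *)
Definition outgoing R : {set edge adj} := touching R :\: inner R.

Definition outgoing_at R i : {set edge adj} := outgoing R :&: incident i.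

Definition boundary R : {set V} :=
  [set i in R | (0 < #|outgoing_at R i|)%N].

Lemma outgoing_touching R : outgoing R \subset touching R.
Proof. exact: subsetDl. Qed.

Lemma incident_touching R (i : {i | i \in R}) :
  incident (val i) \subset touching R.
Proof.
apply/subsetP => e; rewrite !inE => ie.
by apply/existsP; exists (val i); rewrite (valP i).
Qed.

Lemma boundary_sub R : boundary R \subset R.
Proof. by apply/subsetP => i; rewrite inE => /andP[]. Qed.

End Regions.

Record spin_model (K : realType) (V : finType) (adj : rel V) (d : nat) :=
  SpinModel {
    src : edge adj -> V;
    tgt : edge adj -> V;
    edge_ends : forall e, val e = [set src e; tgt e];
    coupling : edge adj -> 'I_d -> 'I_d -> K;
    beta : K }.

(* [phi e i] is only meaningful, and only ever used, when [i] is an endpoint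
   of [e]. *)
Record edge_factors (K : realType) (V : finType) (adj : rel V) (d : nat)
    (M : spin_model K adj d) := EdgeFactors {
  phi : edge adj -> V -> 'M[K[i]]_d;
  phiP : forall e (x y : 'I_d),
    \sum_(a < d) phi e (src M e) x a * phi e (tgt M e) y a
    = (expR (- (beta M / 2) * coupling M e x y))%:C }.

Section PEPS.
Variables (K : realType) (V : finType) (adj : rel V) (d : nat).
Variables (M : spin_model K adj d) (F : edge_factors M).
Implicit Types (i : V) (R : {set V}).

Definition factors_invertible : Prop :=
  forall (e : edge adj) i, i \in val e -> phi F e i \in unitmx.

Definition site_tensor i (x : 'I_d) (a : conf (incident adj i) d) : K[i] :=
  \prod_(e : {e | e \in incident adj i}) phi F (val e) i x (a e).

(* [A_x] with open indices [b]: the bond indices on the edges meeting [R] that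
   agree with [b] on the outgoing edges are exactly the choices of the indices
   summed over on the inner edges. *)
Definition region_tensor R (x : conf R d) (b : conf (outgoing adj R) d)
    : K[i] :=
  \sum_(a : conf (touching adj R) d | restr (outgoing_touching adj R) a == b)
    \prod_(i : {i | i \in R})
      site_tensor (x i) (restr (incident_touching adj i) a).

Definition Gamma R (v : {ffun conf (outgoing adj R) d -> K[i]})
    : {ffun conf R d -> K[i]} :=
  [ffun x => \sum_(b : conf (outgoing adj R) d) region_tensor x b * v b].

Definition injective_region R : Prop := injective (@Gamma R).

Lemma src_inner R (e : {e | e \in inner adj R}) : src M (val e) \in R.
Proof.
case: e => e /=; rewrite inE => /subsetP; apply.
by rewrite (edge_ends M) set21.
Qed.

Lemma tgt_inner R (e : {e | e \in inner adj R}) : tgt M (val e) \in R.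
Proof.
case: e => e /=; rewrite inE => /subsetP; apply.
by rewrite (edge_ends M) set22.
Qed.

Definition src_in R (e : {e | e \in inner adj R}) : {i | i \in R} :=
  exist _ (src M (val e)) (src_inner e).

Definition tgt_in R (e : {e | e \in inner adj R}) : {i | i \in R} :=
  exist _ (tgt M (val e)) (tgt_inner e).

Definition contraction R (x : conf R d) : K[i] :=
  \prod_(e : {e | e \in inner adj R}) \sum_(a < d)
    phi F (val e) (src M (val e)) (x (src_in e)) a *
    phi F (val e) (tgt M (val e)) (x (tgt_in e)) a.

Definition boundary_extendable R : Prop :=
  forall xb : conf (boundary adj R) d,
  exists x : conf R d, restr (boundary_sub adj R) x = xb /\ contraction x != 0.

End PEPS.

(* Main.v *)
Require Import Defs.
From mathcomp Require Import all_boot all_order all_algebra.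
From mathcomp Require Import complex reals sequences exp.

(** The tensor of the region factorises as [C(x)] times a product of entries of
    the matrices [phi] over the outgoing edges, each evaluated at the spin of the
    inner endpoint of the edge.  If every site has at most one outgoing edge,
    these spins can be prescribed independently, so [Gamma] contains the tensor
    product of the invertible [phi]'s.  If a site has two outgoing edges, apply
    the inverse of that tensor product to a basis vector requiring different
    spins at the two edges: the result is a nonzero vector in the kernel. *)

Section Proof.
Set Implicit Arguments.
Unset Strict Implicit.
Unset Printing Implicit Defensive.
Import Order.TTheory GRing.Theory Num.Theory.
Local Open Scope ring_scope.

Section FiniteProducts.

Lemma big_incl (S : Type) (idx : S) (op : Monoid.com_law idx)
    (T : finType) (A B : {set T}) (sAB : A \subset B)
    (F : {x | x \in B} -> S) :
  \big[op/idx]_(x : {x | x \in A}) F (incl sAB x)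
  = \big[op/idx]_(y : {x | x \in B} | val y \in A) F y.
Proof.
rewrite [RHS](reindex_omap (incl sAB) (fun y => insub (val y))) /=.
  by apply: eq_bigl => x; rewrite (valP x) valK eqxx.
move=> y yA; case: insubP => [z _ vz|]; last by rewrite yA.
by congr Some; apply: val_inj.
Qed.

(** Fixing the coordinates in [A] leaves the others free, so distributivity sums each free
    coordinate separately. Serves to contract inner bonds while outgoing ones stay open. *)
Lemma sum_prod_restr (C : comPzRingType) (T : finType) (d : nat)
    (A B : {set T}) (sAB : A \subset B) (b : conf A d)
    (G : {x | x \in B} -> 'I_d -> C) :
  \sum_(a : conf B d | restr sAB a == b) \prod_(t : {x | x \in B}) G t (a t)
  = (\prod_(s : {x | x \in A}) G (incl sAB s) (b s))
    * \prod_(t : {x | x \in B} | val t \notin A) \sum_k G t k.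
Proof.
(* The constraint on [a] is rewritten coordinatewise: [Q t] allows only the prescribed value on [A]
   and every value outside [A]. *)
pose Q (t : {x | x \in B}) : pred 'I_d := fun k =>
  if insub (val t) : option {x | x \in A} is Some s then k == b s else true.
have QA s k : Q (incl sAB s) k = (k == b s) by rewrite /Q valK.
have QN t : val t \notin A -> Q t =1 xpredT by move=> tA k; rewrite /Q insubN.
transitivity (\prod_t \sum_(k | Q t k) G t k).
  rewrite bigA_distr_big_dep; apply: eq_bigl => a; apply/eqP/familyP => [ab t|ha].
    rewrite unfold_in /Q; case: insubP => // s _ vs.
    by rewrite -ab ffunE; apply/eqP; congr (a _); apply: val_inj.
  by apply/ffunP => s; rewrite ffunE; apply/eqP; rewrite -QA; apply: ha.
rewrite (bigID (fun t => val t \in A)) /=; congr (_ * _).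
  rewrite -(big_incl _ sAB); apply: eq_bigr => s _.
  by rewrite (eq_bigl _ _ (QA s)) big_pred1_eq.
by apply: eq_bigr => t tA; apply: eq_bigl; apply: QN.
Qed.

(** Multiplicativity of the tensor product of matrices, read entrywise. *)
Lemma sum_prod_mulmx (C : comPzRingType) (I : finType) (d : nat)
    (P Q : I -> 'M[C]_d) (a b : {ffun I -> 'I_d}) :
  \sum_(c : {ffun I -> 'I_d})
     (\prod_i P i (a i) (c i)) * (\prod_i Q i (c i) (b i))
  = \prod_i (P i *m Q i) (a i) (b i).
Proof.
transitivity (\prod_i \sum_k P i (a i) k * Q i k (b i)).
  by rewrite bigA_distr_bigA; apply: eq_bigr => c _; rewrite -big_split.
by apply: eq_bigr => i _; rewrite mxE.
Qed.

Lemma prod_mx1 (C : comPzRingType) (I : finType) (d : nat)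
    (a b : {ffun I -> 'I_d}) :
  \prod_i (1%:M : 'M[C]_d) (a i) (b i) = (a == b)%:R.
Proof.
have [->|ne_ab] := eqVneq a b.
  by rewrite big1 // => i _; rewrite mxE eqxx.
have /forallPn[i ne_i] : ~~ [forall i, a i == b i].
  apply: contraNN ne_ab => /forallP ab.
  by apply/eqP/ffunP => i; apply/eqP.
by rewrite (bigD1 i) //= mxE (negPf ne_i) mul0r.
Qed.

End FiniteProducts.

Section Region.
Variables (K : realType) (V : finType) (adj : rel V) (d : nat).
Hypothesis adj_irr : irreflexive adj.
Variables (M : spin_model K adj d) (F : edge_factors M) (R : {set V}).

Local Notation outE := {e | e \in outgoing adj R}.
Local Notation outConf := (conf (outgoing adj R) d).
Local Notation site := {i | i \in R}.

Lemma src_neq_tgt (e : edge adj) : src M e != tgt M e.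
Proof.
have := valP e; rewrite inE => /existsP[i /existsP[j /andP[ij /eqP eij]]].
apply: contraTN ij => /eqP st.
have ends k : k \in [set i; j] -> k = src M e.
  by rewrite -eij (edge_ends M) -st setUid inE => /eqP.
by rewrite (ends i) ?set21 // (ends j) ?set22 // adj_irr.
Qed.

(** An outgoing edge meets [R] without lying inside it, so exactly one of its two ends is in [R];
    [p] selects that end. *)
Lemma inner_end_exists : exists p : outE -> site,
  forall (o : outE) (i : site), (val i \in val (val o)) = (i == p o).
Proof.
suff end_o (o : outE) :
    exists q : site, forall i : site, (val i \in val (val o)) = (i == q).
  by have [p] := fin_all_exists end_o; exists p.
case: o => [e /=]; rewrite !inE => /andP[nin /existsP[k /andP[kR ke]]].
exists (Sub k kR) => i; rewrite -(inj_eq val_inj) /=.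
apply/idP/eqP => [ie|->//]; apply: contraNeq nin => ne_ik.
have /= e_ends := edge_ends M e; move: ke ie ne_ik (valP i) kR.
rewrite /= e_ends !inE => ke ie ne_ik iR kR; apply/subsetP => j.
rewrite !inE; move: ke ie ne_ik iR kR.
by move=> /orP[]/eqP-> /orP[]/eqP->; rewrite ?eqxx // => _ ? ? /orP[]/eqP->.
Qed.

Lemma inner_touching : inner adj R \subset touching adj R.
Proof.
apply/subsetP => e; rewrite !inE => /subsetP eR; apply/existsP.
by exists (src M e); rewrite eR (edge_ends M) set21.
Qed.

(** Regroup the product over incident pairs (site, edge) by edges. An outgoing edge keeps the single
    factor of its inner end; summing the bond of an inner edge gives its factor of [C(x)]. *)
Lemma region_tensorE (p : outE -> site)
    (pP : forall (o : outE) (i : site), (val i \in val (val o)) = (i == p o))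
    (x : conf R d) (b : outConf) :
  region_tensor F x b
  = contraction F x * \prod_o phi F (val o) (val (p o)) (x (p o)) (b o).
Proof.
pose G (t : {e | e \in touching adj R}) (k : 'I_d) :=
  \prod_(i : site | val i \in val (val t)) phi F (val t) (val i) (x i) k.
transitivity (\sum_(a : conf (touching adj R) d |
    restr (outgoing_touching adj R) a == b) \prod_t G t (a t)).
  apply: eq_bigr => a _; rewrite /G (exchange_big_dep xpredT) //=.
  apply: eq_bigr => i _; rewrite /site_tensor.
  rewrite -(eq_bigl _ _ (fun t => in_set (fun e : edge adj => val i \in val e) (val t))).
  rewrite -(big_incl _ (incident_touching adj i)).
  by apply: eq_bigr => e _; rewrite ffunE.
rewrite sum_prod_restr mulrC; congr (_ * _); last first.
  by apply: eq_bigr => o _; rewrite /G (eq_bigl _ _ (pP o)) big_pred1_eq.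
rewrite (eq_bigl (fun t => val t \in inner adj R)); last first.
  by move=> t; rewrite [in LHS]inE (valP t) andbT negbK.
rewrite -(big_incl _ inner_touching).
apply: eq_bigr => e _; apply: eq_bigr => k _; rewrite /G.
(* An inner edge collects one factor from each end, and the ends are distinct because there are no
   loops. *)
have ne_st := src_neq_tgt (val e).
rewrite (bigD1 (src_in M e)) /=; last by rewrite (edge_ends M) set21.
rewrite (big_pred1 (tgt_in M e)) // => i.
rewrite (edge_ends M) !inE -!(inj_eq val_inj) /=.
have [->|ne_i] := eqVneq (val i) (src M (val e)); last by rewrite andbT.
by rewrite (negPf ne_st).
Qed.

Hypothesis F_unit : factors_invertible F.

Lemma injective_at_most_one_outgoing : (2 <= d)%N -> injective_region F R ->
  forall i, i \in R -> (#|outgoing_at adj R i| <= 1)%N.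
Proof.
move=> d2 inj i iR; rewrite leqNgt; apply/negP => /card_gt1P[e1 [e2 []]].
rewrite !in_setI => /andP[o1 i1] /andP[o2 i2] ne12.
have [p pP] := inner_end_exists.
pose P (o : outE) := phi F (val o) (val (p o)).
have PU o : P o \in unitmx by apply: F_unit; rewrite pP.
pose k0 : 'I_d := Ordinal (ltnW d2); pose k1 : 'I_d := Ordinal d2.
(* [y] asks for different spins at [e1] and [e2], which share the inner end [i]; [v] is column [y]
   of the inverse of the tensor product of the [P o]. *)
pose y : outConf := [ffun o => if val o == e1 then k0 else k1].
pose v : {ffun outConf -> K[i]%C} :=
  [ffun b : outConf => \prod_o invmx (P o) (b o) (y o)].
have tensorv (c : outConf) : \sum_(b : outConf) (\prod_o P o (c o) (b o)) * v b = (c == y)%:R.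
  under eq_bigr do rewrite ffunE.
  rewrite sum_prod_mulmx -prod_mx1; apply: eq_bigr => o _.
  by rewrite mulmxV.
have Gv0 : Gamma F v = Gamma F 0.
  apply/ffunP => x; rewrite !ffunE [RHS]big1; last first.
    by move=> b _; rewrite ffunE mulr0.
  pose c : outConf := [ffun o => x (p o)].
  transitivity (contraction F x * \sum_(b : outConf) (\prod_o P o (c o) (b o)) * v b).
    rewrite mulr_sumr; apply: eq_bigr => b _.
    rewrite (region_tensorE pP) mulrA; congr (_ * _ * _).
    by apply: eq_bigr => o _; rewrite ffunE.
  (* The amplitude can survive only if [c = y]; but [c] takes the value of [x] at [i] on both [e1]
     and [e2]. *)
  rewrite tensorv; case: eqP => [cy|_]; last by rewrite mulr0.
  have pi (e : edge adj) (oe : e \in outgoing adj R) : e \in incident adj i ->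
      p (Sub e oe) = Sub i iR.
    by rewrite inE => ie; apply/esym/eqP; rewrite -pP.
  have := congr1 (fun f : outConf => f (Sub e1 o1)) cy.
  have := congr1 (fun f : outConf => f (Sub e2 o2)) cy.
  rewrite /= !ffunE !pi //= eqxx eq_sym (negPf ne12) => ->.
  by move/(congr1 val).
(* Injectivity would force [v = 0], yet the tensor product maps [v] to a vector with entry 1 at
   [y]. *)
have := tensorv y; rewrite (inj _ _ Gv0) eqxx big1 => [/eqP|b _].
  by rewrite eq_sym oner_eq0.
by rewrite ffunE mulr0.
Qed.

Lemma at_most_one_outgoing_injective : boundary_extendable F R ->
  (forall i, i \in R -> (#|outgoing_at adj R i| <= 1)%N) ->
  injective_region F R.
Proof.
move=> ext out1; have [p pP] := inner_end_exists.
pose P (o : outE) := phi F (val o) (val (p o)).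
have PU o : P o \in unitmx by apply: F_unit; rewrite pP.
have out_at (o : outE) : val o \in outgoing_at adj R (val (p o)).
  by rewrite inE (valP o) inE pP /=.
have p_inj : injective p.
  move=> o o' pp; apply: val_inj.
  apply: (card_le1_eqP (out1 _ (valP (p o)))); last exact: out_at.
  by rewrite pp; apply: out_at.
have pB o : val (p o) \in boundary adj R.
  by rewrite inE (valP (p o)) card_gt0; apply/set0Pn; exists (val o).
(* Since [p] is injective, [c] prescribes one spin per boundary site without conflict; extendability
   then supplies [x] with [C(x)] nonzero. *)
have realise (c : outConf) :
    exists2 x : conf R d, contraction F x != 0 & forall o, x (p o) = c o.
  have spin (s : {i | i \in boundary adj R}) :
      exists k, forall o, val (p o) = val s -> c o = k.
    have := valP s; rewrite inE card_gt0 => /andP[sR /set0Pn[e]].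
    rewrite in_setI => /andP[eo es].
    exists (c (Sub e eo)) => o ps; congr (c _); apply: p_inj; apply/eqP.
    by rewrite -pP /= ps; move: es; rewrite inE.
  have [xb xbP] := fin_all_exists spin.
  have [x [xxb Cx]] := ext (finfun xb).
  exists x => // o; rewrite (xbP (Sub (val (p o)) (pB o)) o) //.
  have /ffunP/(_ (Sub (val (p o)) (pB o))) := xxb.
  by rewrite !ffunE => <-; congr (x _); apply: val_inj.
(* [S v] is the image of [v] under the tensor product of the [P o]; [invS] recovers [v] through the
   inverse matrices. *)
pose S (v : {ffun outConf -> K[i]%C}) (c : outConf) :=
  \sum_(b : outConf) (\prod_o P o (c o) (b o)) * v b.
have GS v (c : outConf) (x : conf R d) :
    (forall o, x (p o) = c o) -> Gamma F v x = contraction F x * S v c.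
  move=> xc; rewrite ffunE mulr_sumr; apply: eq_bigr => b _.
  rewrite (region_tensorE pP) mulrA; congr (_ * _ * _).
  by apply: eq_bigr => o _; rewrite xc.
have invS v (a : outConf) : \sum_(c : outConf) (\prod_o invmx (P o) (a o) (c o)) * S v c = v a.
  transitivity (\sum_(b : outConf) (a == b)%:R * v b); last first.
    rewrite (bigD1 a) //= eqxx mul1r big1 ?addr0 // => b.
    by rewrite eq_sym => /negPf->; rewrite mul0r.
  under eq_bigr do rewrite mulr_sumr.
  rewrite exchange_big; apply: eq_bigr => b _ /=.
  under eq_bigr do rewrite mulrA.
  rewrite -mulr_suml sum_prod_mulmx -prod_mx1; congr (_ * _).
  by apply: eq_bigr => o _; rewrite mulVmx.
move=> v w Gvw; apply/ffunP => a; rewrite -!invS; apply: eq_bigr => c _.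
(* Each entry of [S v] appears in [Gamma F v] multiplied by a nonzero [C(x)], which can be
   cancelled. *)
congr (_ * _); have [x Cx xc] := realise c.
by apply: (mulfI Cx); rewrite -!GS // Gvw.
Qed.

End Region.
End Proof.

Theorem mainTheorem2 (K : realType) (V : finType) (adj : rel V)
    (adj_sym : symmetric adj) (adj_irr : irreflexive adj)
    (R : {set V}) (R_neq0 : R != set0) :
  (forall (d : nat) (M : spin_model K adj d) (F : edge_factors M),
     (2 <= d)%N -> factors_invertible F -> boundary_extendable F R ->
     (injective_region F R <->
      (forall i : V, i \in R -> (#|outgoing_at adj R i| <= 1)%N)))
  /\
  (forall (d : nat) (M : spin_model K adj d) (F : edge_factors M)
          (d' : nat) (M' : spin_model K adj d') (F' : edge_factors M'),
     (2 <= d)%N -> factors_invertible F -> boundary_extendable F R ->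
     (2 <= d')%N -> factors_invertible F' -> boundary_extendable F' R ->
     (injective_region F R <-> injective_region F' R)).
Proof.
have main d (M : spin_model K adj d) (F : edge_factors M) :
    (2 <= d)%N -> factors_invertible F -> boundary_extendable F R ->
    (injective_region F R <->
     (forall i : V, i \in R -> (#|outgoing_at adj R i| <= 1)%N)).
  move=> d2 Fu ext; split; first exact: injective_at_most_one_outgoing.
  exact: at_most_one_outgoing_injective.
split=> // d M F d' M' F' d2 Fu ext d2'.
(* Both injectivity statements are equivalent to the same condition on the graph, which mentions
   neither the model nor [d]. *)
move=> Fu' ext'; split=> [/(main _ _ _ d2 Fu ext)|/(main _ _ _ d2' Fu' ext')] out1.
  exact/main.
exact/main.
Qed.
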